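(* Let $W=W(\Gamma,\mathbf m)$ be a graph product of directly-indecomposable cyclic groups. Then the following are equivalent: (1) $\operatorname{Out}^0W$ is an abelian group; (2) $\Gamma$ does not contain a SIL (separating intersection of links).
   Context: $\Gamma$ is a finite simplicial graph with non-empty vertex set $V=\{v_1,\dots,v_N\}$, with the indexing fixed; $d$ is the path metric on $\Gamma$ (vertices in different components are at distance $\infty$). An order map is a function $\mathbf m:\{1,\dots,N\}\to\{p^\alpha : p \text{ prime},\ \alpha\ge 1\}\cup\{\infty\}$. The graph product of directly-indecomposable cyclic groups $W=W(\Gamma,\mathbf m)$ is the group with generators $V$ and relations $v_i^{\mathbf m(i)}=1$ (no relation if $\mathbf m(i)=\infty$) and $v_jv_k=v_kv_j$ whenever $v_j,v_k$ are adjacent in $\Gamma$. $L_i$ (resp. $S_i$) is the link (resp. star) of $v_i$: the full subgraph on the vertices at distance exactly $1$ (resp. at most $1$) from $v_i$. For $1\le i\le N$ and $K$ a connected component of $\Gamma\setminus S_i$, the partial conjugation $\chi_{iK}$ is the automorphism of $W$ with $\chi_{iK}(v_j)=v_iv_jv_i^{-1}$ if $v_j\in K$ and $\chi_{iK}(v_j)=v_j$ if $v_j\notin K$. $\mathcal P$ is the set of all partial conjugations. For each $i$ with $\Gamma\setminus S_i\ne\emptyset$ let $j_i$ be minimal such that $v_{j_i}\in\Gamma\setminus S_i$, and let $\mathcal P^0=\{\chi_{iK}\in\mathcal P: v_{j_i}\notin K\}$. $\operatorname{Out}^0W$ is the subgroup of $\operatorname{Aut}W$ generated by $\mathcal P^0$.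 $\Gamma$ contains a SIL if there exist $1\le i<j\le N$ such that $d(v_i,v_j)\ge2$ and there is a connected component $R$ of $\Gamma\setminus(L_i\cap L_j)$ with $v_i,v_j\notin R$. *)

(* Defs.v *)
From HB Require Import structures.
From mathcomp Require Import all_boot generic_quotient.
From mathcomp Require Import boolp classical_sets.

Set Implicit Arguments.
Unset Strict Implicit.
Unset Printing Implicit Defensive.

Local Open Scope quotient_scope.
Local Open Scope group_scope.

(** * Finite simplicial graphs on the vertex set ['I_N] *)

Section Graph.
Variables (N : nat) (e : rel 'I_N).
Implicit Types (i j x y : 'I_N) (A : {set 'I_N}).

Definition walk (n : nat) x y : bool :=
  [exists p : n.-tuple 'I_N, path e x p && (last x p == y)].

(* [None] is the distance between vertices in different components. *)
Definition gdist x y : option nat :=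
  match pselect (exists n, walk n x y) with
  | left walk_xy => Some (ex_minn walk_xy)
  | right _ => None
  end.

Definition gdist_le x y (n : nat) : bool :=
  if gdist x y is Some k then (k <= n)%N else false.

Definition gdist_ge x y (n : nat) : bool :=
  if gdist x y is Some k then (n <= k)%N else true.

Definition link i : {set 'I_N} := [set j | gdist i j == Some 1%N].
Definition star i : {set 'I_N} := [set j | gdist_le i j 1].

(* Adjacency in the full subgraph of the graph on the vertex set A. *)
Definition induced A : rel 'I_N := [rel x y | [&& x \in A, y \in A & e x y]].

Definition components A : {set {set 'I_N}} :=
  equivalence_partition (connect (induced A)) A.

Lemma gdist_leP x y n :
  reflect (exists2 k, (k <= n)%N & walk k x y) (gdist_le x y n).
Proof.
rewrite /gdist_le /gdist; case: pselect => [walk_xy | no_walk].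
  case: ex_minnP => k k_walk k_min; apply: (iffP idP) => [kn | [l ln l_walk]].
    by exists k.
  exact: leq_trans (k_min _ l_walk) ln.
by constructor=> -[k _ k_walk]; apply: no_walk; exists k.
Qed.

Lemma walk0 x y : walk 0 x y = (y == x).
Proof.
apply/existsP/eqP => [[p]|->]; first by rewrite tuple0 => /eqP.
by exists [tuple]; rewrite /= eqxx.
Qed.

Lemma walk1 x y : walk 1 x y = e x y.
Proof.
apply/existsP/idP => [[[[|z [|w s]] sz]]|exy] //=.
  by rewrite andbT => /andP[exz /eqP <-].
by exists [tuple y]; rewrite /= exy eqxx.
Qed.

Lemma in_star i j : (j \in star i) = (j == i) || e i j.
Proof.
rewrite inE; apply/gdist_leP/orP => [[[|[|//]] _]|[ji|ij]].
- by rewrite walk0; left.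
- by rewrite walk1; right.
- by exists 0%N; rewrite ?walk0.
- by exists 1%N; rewrite ?walk1.
Qed.

Lemma gdist1 x y : (gdist x y == Some 1%N) = (y != x) && e x y.
Proof.
have := in_star x y; rewrite inE /gdist_le /gdist.
case: pselect => [walk_xy|no_walk] /=; last first.
  by case: eqP => //= _ <-.
case: ex_minnP => -[|[|k]] k_walk k_min.
- by rewrite walk0 in k_walk; rewrite k_walk.
- rewrite walk1 in k_walk; rewrite k_walk andbT => _.
  by apply/esym/negP; rewrite -walk0 => /k_min.
- by case: eqP => //= _ <-.
Qed.

Lemma in_link i j : irreflexive e -> (j \in link i) = e i j.
Proof.
by move=> e_irr; rewrite inE gdist1; case: eqP => //= ->; rewrite e_irr.
Qed.

Lemma component_sub A K : K \in components A -> K \subset A.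
Proof.
case/imsetP=> x xA ->; apply/fintype.subsetP=> y; rewrite inE => /andP[] //.
Qed.

Lemma component_closed A K x y : K \in components A ->
  x \in K -> y \in A -> e x y -> y \in K.
Proof.
move=> KA xK yA exy; have xA := fintype.subsetP (component_sub KA) _ xK.
case/imsetP: KA xK => z zA ->; rewrite !inE yA => /andP[_ zx] /=.
by apply: connect_trans zx _; apply: connect1; rewrite /induced /= xA yA.
Qed.

Definition has_SIL : Prop :=
  exists i j, [/\ (i < j)%N, gdist_ge i j 2 &
    exists2 R, R \in components (~: (link i :&: link j)) &
               (i \notin R) /\ (j \notin R)].

End Graph.

(** * Groups given by generators and relations *)

(* The letter [(x, true)] stands for x, the letter [(x, false)] for x^-1. *)
Definition word (T : choiceType) := seq (T * bool).

Section Presentation.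
Variables (T : choiceType) (R : word T -> word T -> Prop).

(* [R u v] is the defining relation u = v. *)
Inductive word_eq : word T -> word T -> Prop :=
| word_eq_refl u : word_eq u u
| word_eq_sym u v : word_eq u v -> word_eq v u
| word_eq_trans u v w : word_eq u v -> word_eq v w -> word_eq u w
| word_eq_cat u u' v v' :
    word_eq u u' -> word_eq v v' -> word_eq (u ++ v) (u' ++ v')
| word_eq_cancel x b : word_eq [:: (x, b); (x, ~~ b)] [::]
| word_eq_rel u v : R u v -> word_eq u v.

Definition word_eqb : rel (word T) := fun u v => `[< word_eq u v >].

Lemma word_eqb_refl : reflexive word_eqb.
Proof. by move=> u; apply/asboolP; exact: word_eq_refl. Qed.

Lemma word_eqb_sym : symmetric word_eqb.
Proof. by move=> u v; apply/asboolP/asboolP; exact: word_eq_sym. Qed.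

Lemma word_eqb_trans : transitive word_eqb.
Proof.
by move=> v u w /asboolP uv /asboolP vw; apply/asboolP; exact: word_eq_trans vw.
Qed.

Canonical word_equiv :=
  EquivRel word_eqb word_eqb_refl word_eqb_sym word_eqb_trans.

Definition presented := {eq_quot word_equiv}.
HB.instance Definition _ := Choice.on presented.

Definition pres_class (u : word T) : presented := \pi_presented u.

Lemma pres_classK (x : presented) : pres_class (repr x) = x.
Proof. exact: reprK. Qed.

Lemma presentedP (u v : word T) :
  pres_class u = pres_class v <-> word_eq u v.
Proof. by split=> [/eqmodP/asboolP|uv] //; apply/eqmodP/asboolP. Qed.

Lemma reprK_eq (u : word T) : word_eq (repr (pres_class u)) u.
Proof. by apply/presentedP; rewrite pres_classK. Qed.

Definition word_inv (u : word T) : word T :=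
  rev [seq (a.1, ~~ a.2) | a <- u].

Definition pres_one : presented := pres_class [::].
Definition pres_mul (x y : presented) : presented :=
  pres_class (repr x ++ repr y).
Definition pres_inv (x : presented) : presented :=
  pres_class (word_inv (repr x)).

Lemma pres_mulE u v :
  pres_mul (pres_class u) (pres_class v) = pres_class (u ++ v).
Proof. by apply/presentedP; apply: word_eq_cat; exact: reprK_eq. Qed.

Lemma word_invK : involutive word_inv.
Proof.
move=> u; rewrite /word_inv map_rev revK -map_comp -[RHS]map_id.
by apply: eq_map => -[x b] /=; rewrite negbK.
Qed.

Lemma word_eq_mulV u : word_eq (u ++ word_inv u) [::].
Proof.
elim: u => [|[x b] u IHu]; first exact: word_eq_refl.
apply: word_eq_trans (word_eq_cancel x b).
have -> : word_inv ((x, b) :: u) = word_inv u ++ [:: (x, ~~ b)].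
  by rewrite /word_inv /= rev_cons cats1.
have uVu : word_eq (u ++ word_inv u ++ [:: (x, ~~ b)]) [:: (x, ~~ b)].
  by rewrite catA; exact: (word_eq_cat IHu (word_eq_refl [:: (x, ~~ b)])).
exact: (word_eq_cat (word_eq_refl [:: (x, b)]) uVu).
Qed.

Lemma word_eq_mulVw u : word_eq (word_inv u ++ u) [::].
Proof. by rewrite -{2}[u]word_invK; exact: word_eq_mulV. Qed.

Fact pres_mulA : associative pres_mul.
Proof.
move=> x y z; rewrite -[x]pres_classK -[y]pres_classK -[z]pres_classK.
rewrite (pres_mulE (repr y)) (pres_mulE (repr x) (repr y)).
by rewrite (pres_mulE (repr x)) pres_mulE catA.
Qed.

Fact pres_mul1 : left_id pres_one pres_mul.
Proof. by move=> x; rewrite -[x]pres_classK pres_mulE. Qed.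

Fact pres_mulr1 : right_id pres_one pres_mul.
Proof. by move=> x; rewrite -[x]pres_classK pres_mulE cats0. Qed.

Fact pres_mulV : left_inverse pres_one pres_inv pres_mul.
Proof.
move=> x; rewrite -{2}[x]pres_classK pres_mulE.
by apply/presentedP; exact: word_eq_mulVw.
Qed.

Fact pres_mulrV : right_inverse pres_one pres_inv pres_mul.
Proof.
move=> x; rewrite -{1}[x]pres_classK pres_mulE.
by apply/presentedP; exact: word_eq_mulV.
Qed.

HB.instance Definition _ := isGroup.Build presented
  pres_mulA pres_mul1 pres_mulr1 pres_mulV pres_mulrV.

Definition pres_gen (x : T) : presented := pres_class [:: (x, true)].

Section Lift.
Variables (H : groupType) (f : T -> H).

Definition word_eval (u : word T) : H :=
  foldr (fun a h => (if a.2 then f a.1 else (f a.1)^-1) * h) 1 u.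

Lemma word_eval_cat u v : word_eval (u ++ v) = word_eval u * word_eval v.
Proof. by elim: u => [|a u IHu] /=; rewrite ?mul1g // IHu mulgA. Qed.

Definition pres_lift (x : presented) : H := word_eval (repr x).

Hypothesis fR : forall u v, R u v -> word_eval u = word_eval v.

Lemma word_eval_eq u v : word_eq u v -> word_eval u = word_eval v.
Proof.
elim=> //= {u v} [u v w _ -> _ -> //|u u' v v' _ IHu _ IHv|x b].
  by rewrite !word_eval_cat IHu IHv.
by rewrite mulg1; case: b; rewrite ?mulgV ?mulVg.
Qed.

Lemma pres_lift_class u : pres_lift (pres_class u) = word_eval u.
Proof. by apply: word_eval_eq; exact: reprK_eq. Qed.

Lemma pres_lift_gen x : pres_lift (pres_gen x) = f x.
Proof. by rewrite pres_lift_class /= mulg1. Qed.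

Lemma pres_liftM : {morph pres_lift : x y / x * y}.
Proof.
move=> x y; rewrite -[x]pres_classK -[y]pres_classK.
by rewrite [_ * _]pres_mulE !pres_lift_class word_eval_cat.
Qed.

End Lift.

Lemma pres_class_inv u : (pres_class u)^-1 = pres_class (word_inv u).
Proof.
apply: (mulgI (pres_class u)); rewrite mulgV [RHS]pres_mulE.
by apply/esym/presentedP; exact: word_eq_mulV.
Qed.

Lemma pres_class_eval u : pres_class u = word_eval pres_gen u.
Proof.
elim: u => [|[x b] u IHu] //=; rewrite -IHu -cat1s -pres_mulE.
by congr (_ * _); case: b => //; rewrite pres_class_inv.
Qed.

Lemma pres_hom_eval (H : groupType) (g : presented -> H) u :
  {morph g : x y / x * y} ->
  g (pres_class u) = word_eval (g \o pres_gen) u.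
Proof.
move=> gM; have g1 : g 1 = 1.
  by apply: (mulgI (g 1)); rewrite -gM !mulg1.
have gV x : g x^-1 = (g x)^-1.
  by apply: (mulgI (g x)); rewrite -gM !mulgV.
rewrite pres_class_eval; elim: u => [|[x b] u IHu] //=.
by rewrite gM IHu; case: b; rewrite ?gV.
Qed.

Lemma pres_hom_ext (H : groupType) (g h : presented -> H) :
  {morph g : x y / x * y} -> {morph h : x y / x * y} ->
  (forall x, g (pres_gen x) = h (pres_gen x)) -> g = h.
Proof.
move=> gM hM gh; apply/funext=> x.
rewrite -[x]pres_classK !pres_hom_eval //; congr word_eval; exact/funext.
Qed.

End Presentation.

(** * Automorphism groups and subgroups *)

Definition is_automorphism (G : groupType) (f : G -> G) : Prop :=
  {morph f : x y / x * y} /\ bijective f.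

Section Aut.
Variable G : groupType.

Definition Aut_pred : pred (G -> G) := fun f => `[< is_automorphism f >].
Record Aut := MkAut { aut_fun :> G -> G; autP : Aut_pred aut_fun }.

HB.instance Definition _ := [isSub for aut_fun].
HB.instance Definition _ := gen_eqMixin Aut.
HB.instance Definition _ := gen_choiceMixin Aut.

Lemma autM (f : Aut) : {morph f : x y / x * y}.
Proof. by have /asboolP[] := autP f. Qed.

Lemma aut_bij (f : Aut) : bijective f.
Proof. by have /asboolP[] := autP f. Qed.

Lemma aut_ext (f g : Aut) : f =1 g -> f = g.
Proof. by move=> fg; apply/val_inj/funext. Qed.

Fact aut_one_subproof : Aut_pred id.
Proof. by apply/asboolP; split=> //; exists id. Qed.
Definition aut_one : Aut := MkAut aut_one_subproof.

Fact aut_mul_subproof (f g : Aut) : Aut_pred (f \o g).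
Proof.
apply/asboolP; split; last exact: bij_comp (aut_bij f) (aut_bij g).
by move=> x y /=; rewrite !autM.
Qed.
Definition aut_mul (f g : Aut) : Aut := MkAut (aut_mul_subproof f g).

Fact aut_inv_exists (f : Aut) : exists g : Aut, cancel f g /\ cancel g f.
Proof.
have [g fK gK] := aut_bij f.
have gP : Aut_pred g.
  apply/asboolP; split; last by exists f.
  by move=> x y; rewrite -{1}[x]gK -{1}[y]gK -autM fK.
by exists (MkAut gP).
Qed.
Definition aut_inv (f : Aut) : Aut := projT1 (cid (aut_inv_exists f)).

Lemma aut_invK (f : Aut) : cancel f (aut_inv f).
Proof. by rewrite /aut_inv; case: cid => g []. Qed.

Lemma aut_invKV (f : Aut) : cancel (aut_inv f) f.
Proof. by rewrite /aut_inv; case: cid => g []. Qed.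

Fact aut_mulA : associative aut_mul.
Proof. by move=> f g h; exact: aut_ext. Qed.
Fact aut_mul1 : left_id aut_one aut_mul.
Proof. by move=> f; exact: aut_ext. Qed.
Fact aut_mulr1 : right_id aut_one aut_mul.
Proof. by move=> f; exact: aut_ext. Qed.
Fact aut_mulV : left_inverse aut_one aut_inv aut_mul.
Proof. by move=> f; apply: aut_ext; exact: aut_invK. Qed.
Fact aut_mulrV : right_inverse aut_one aut_inv aut_mul.
Proof. by move=> f; apply: aut_ext; exact: aut_invKV. Qed.

HB.instance Definition _ := isGroup.Build Aut
  aut_mulA aut_mul1 aut_mulr1 aut_mulV aut_mulrV.

End Aut.

Definition is_subgroup (G : groupType) (H : set G) : Prop :=
  [/\ H 1, forall x y, H x -> H y -> H (x * y) & forall x, H x -> H x^-1].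

Definition subgroup_generated (G : groupType) (A : set G) : set G :=
  smallest (@is_subgroup G) A.

Definition abelian_subgroup (G : groupType) (H : set G) : Prop :=
  forall x y, H x -> H y -> commute x y.

(** * Graph products of directly-indecomposable cyclic groups *)

(* [None] is the order infinity. *)
Definition order_map (N : nat) (m : 'I_N -> option nat) : Prop :=
  forall i k, m i = Some k ->
    exists p a, [/\ prime p, (1 <= a)%N & k = (p ^ a)%N].

Section GraphProduct.
Variables (N : nat) (e : rel 'I_N) (m : 'I_N -> option nat).

Inductive gp_rel : word 'I_N -> word 'I_N -> Prop :=
| gp_rel_order i k : m i = Some k -> gp_rel (nseq k (i, true)) [::]
| gp_rel_comm j k : e j k ->
    gp_rel [:: (j, true); (k, true)] [:: (k, true); (j, true)].

Definition graph_product : groupType := presented gp_rel.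

Definition gp_gen (i : 'I_N) : graph_product := pres_gen gp_rel i.

Definition is_partial_conj (i : 'I_N) (K : {set 'I_N})
    (chi : graph_product -> graph_product) : Prop :=
  forall j, chi (gp_gen j) =
    if j \in K then gp_gen i * gp_gen j * (gp_gen i)^-1 else gp_gen j.

Lemma gp_genX i k : m i = Some k -> gp_gen i ^+ k = 1.
Proof.
move=> mi; have <- : word_eval gp_gen (nseq k (i, true)) = gp_gen i ^+ k.
  by elim: k {mi} => [|k IHk] //=; rewrite IHk expgS.
rewrite -pres_class_eval; apply/presentedP; apply: word_eq_rel.
exact: gp_rel_order.
Qed.

Lemma gp_genC j k : e j k -> commute (gp_gen j) (gp_gen k).
Proof.
have mulE a b :
    gp_gen a * gp_gen b = pres_class gp_rel [:: (a, true); (b, true)].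
  exact: (pres_mulE gp_rel [:: (a, true)] [:: (b, true)]).
move=> jk; rewrite /commute !mulE.
by apply/presentedP; apply: word_eq_rel; exact: gp_rel_comm.
Qed.

Definition conj_gen (g : graph_product) (K : {set 'I_N}) (j : 'I_N) :=
  if j \in K then g * gp_gen j * g^-1 else gp_gen j.

Lemma conj_gen_rel i K g :
  irreflexive e -> symmetric e -> K \in components e (~: star e i) ->
  (forall k, commute (gp_gen i) (gp_gen k) -> commute g (gp_gen k)) ->
  forall u v, gp_rel u v ->
    word_eval (conj_gen g K) u = word_eval (conj_gen g K) v.
Proof.
move=> e_irr e_sym KA gC u v.
have conjM (x y : graph_product) :
    g * x * g^-1 * (g * y * g^-1) = g * (x * y) * g^-1.
  by rewrite !mulgA mulgVK.
have edge_out j k : e j k -> j \in K -> k \notin K -> commute g (gp_gen k).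
  move=> jk jK kK; have : k \in star e i.
    apply: contraR kK => kS; apply: (component_closed KA jK _ jk).
    by rewrite finset.in_setC.
  rewrite in_star => /orP[/eqP->|ik]; apply: gC => //; exact: gp_genC.
case=> {u v} [j k mj | j k jk] /=.
  have -> : word_eval (conj_gen g K) (nseq k (j, true)) = conj_gen g K j ^+ k.
    by elim: k {mj} => [|k IHk] //=; rewrite IHk expgS.
  rewrite /conj_gen; case: ifP => _; last exact: gp_genX.
  suff -> : (g * gp_gen j * g^-1) ^+ k = g * gp_gen j ^+ k * g^-1.
    by rewrite gp_genX // mulg1 mulgV.
  elim: k {mj} => [|k IHk]; first by rewrite !expg0 mulg1 mulgV.
  by rewrite !expgS IHk conjM.
have cjk := gp_genC jk; rewrite !mulg1 /conj_gen.
have fixed (x y : graph_product) : commute x y -> commute g y ->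
    commute (g * x * g^-1) y.
  move=> xy gy; have -> : y = g * y * g^-1 by rewrite gy mulgK.
  by rewrite /commute !conjM xy.
case: ifPn => jK; case: ifPn => kK //.
- by rewrite !conjM cjk.
- by apply: fixed => //; exact: edge_out jk jK kK.
- apply/esym/fixed; first exact/esym.
  by apply: edge_out kK jK; rewrite e_sym.
Qed.

Lemma partial_conj_exists i K :
  irreflexive e -> symmetric e -> K \in components e (~: star e i) ->
  exists chi : Aut graph_product, is_partial_conj i K chi.
Proof.
move=> e_irr e_sym KA; set g := gp_gen i.
have iK : i \notin K.
  apply/negP => /(fintype.subsetP (component_sub KA)).
  by rewrite inE in_star eqxx.
have gR := @conj_gen_rel i K g e_irr e_sym KA (fun k gk => gk).
have gVR : forall u v, gp_rel u v ->
    word_eval (conj_gen g^-1 K) u = word_eval (conj_gen g^-1 K) v.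
  apply: conj_gen_rel KA _ => // k gk; apply: (mulgI g); apply: (mulIg g).
  by rewrite !mulgA mulgV mul1g mulgVK gk.
pose chi : graph_product -> graph_product :=
  pres_lift (conj_gen g K).
pose chiV : graph_product -> graph_product :=
  pres_lift (conj_gen g^-1 K).
have chiM : {morph chi : x y / x * y} by exact: pres_liftM gR.
have chiVM : {morph chiV : x y / x * y} by exact: pres_liftM gVR.
have chiE j : chi (gp_gen j) = conj_gen g K j by exact: pres_lift_gen gR j.
have chiVE j : chiV (gp_gen j) = conj_gen g^-1 K j
  by exact: pres_lift_gen gVR j.
have hV (h : graph_product -> graph_product) x :
    {morph h : x y / x * y} -> h x^-1 = (h x)^-1.
  move=> hM; have h1 : h 1 = 1 by apply: (mulgI (h 1)); rewrite -hM !mulg1.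
  by apply: (mulgI (h x)); rewrite -hM !mulgV.
have chig : chi g = g by rewrite chiE /conj_gen (negbTE iK).
have chiVg : chiV g = g by rewrite chiVE /conj_gen (negbTE iK).
have chiK : cancel chi chiV.
  suff: chiV \o chi = id by move=> E x; rewrite -[RHS]/(id x) -E.
  apply: pres_hom_ext => [x y|//|j] /=; first by rewrite chiM chiVM.
  rewrite -[pres_gen _ j]/(gp_gen j) chiE /conj_gen; case: ifPn => jK.
    rewrite !chiVM (hV chiV) // chiVg chiVE /conj_gen jK invgK.
    by rewrite !mulgA mulgV mul1g mulgK.
  by rewrite chiVE /conj_gen (negbTE jK).
have chiVK : cancel chiV chi.
  suff: chi \o chiV = id by move=> E x; rewrite -[RHS]/(id x) -E.
  apply: pres_hom_ext => [x y|//|j] /=; first by rewrite chiVM chiM.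
  rewrite -[pres_gen _ j]/(gp_gen j) chiVE /conj_gen; case: ifPn => jK.
    rewrite !chiM !(hV chi) // chig chiE /conj_gen jK invgK.
    by rewrite !mulgA mulVg mul1g mulgVK.
  by rewrite chiE /conj_gen (negbTE jK).
have chi_aut : Aut_pred chi by apply/asboolP; split=> //; exists chiV.
by exists (MkAut chi_aut).
Qed.

Lemma partial_conj_unique i K (chi psi : Aut graph_product) :
  is_partial_conj i K chi -> is_partial_conj i K psi -> chi = psi.
Proof.
move=> chiE psiE; apply: val_inj.
apply: pres_hom_ext => [||j]; [exact: autM | exact: autM |].
by rewrite [LHS]chiE [RHS]psiE.
Qed.

(* [is_j_min i j] says that j is j_i. *)
Definition is_j_min (i j : 'I_N) : Prop :=
  j \in ~: star e i /\ forall k, k \in ~: star e i -> (j <= k)%N.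

Definition partial_conjs0 : set (Aut graph_product) :=
  fun chi => exists i K, [/\ K \in components e (~: star e i),
    is_partial_conj i K chi & forall j, is_j_min i j -> j \notin K].

Definition Out0 : set (Aut graph_product) :=
  subgroup_generated partial_conjs0.

End GraphProduct.

Arguments partial_conjs0 {N} e m.
Arguments Out0 {N} e m.

(* Main.v *)
Require Import Defs.
From mathcomp Require Import all_boot boolp classical_sets.
From mathcomp Require Import fintype finset fingroup perm.

(* Let v_i, v_j be non-adjacent and distinct. Without a SIL, a component K of
   the complement of the star of v_i that misses v_j has a neighbour in L_i
   outside L_j, so K lies in the component of the complement of the star of v_j
   that contains v_i. Hence chi_iK and chi_jQ commute except possibly when
   v_j is in K and v_i is in Q; then the basepoints j_i and j_j each lie in the
   other's complement, so they coincide by minimality, which contradicts that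
   the basepoints avoid K and Q.
   Conversely, a SIL component R is a component for both v_i and v_j. For each
   of them, P^0 contains the partial conjugation by R or the one by the
   component containing the other vertex. All four resulting commutators are
   nontrivial because v_i, v_j and any r in R act on a wedge of three cycles,
   each rotating its own cycle. *)

Set Implicit Arguments.
Unset Strict Implicit.
Unset Printing Implicit Defensive.

(** * Components of induced subgraphs, stars and SILs *)

Section Components.
Variables (N : nat) (e : rel 'I_N).
Hypothesis (e_sym : symmetric e).
Implicit Types (i j k x y : 'I_N) (A B K : {set 'I_N}).

Lemma connect_induced_sym A : connect_sym (induced e A).
Proof.
by apply: sym_connect_sym => x y; rewrite /induced /= [e x y]e_sym andbCA.
Qed.

Lemma connect_induced_closed B K x y :
    (forall a b, a \in K -> b \in B -> e a b -> b \in K) ->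
  x \in K -> connect (induced e B) x y -> y \in K.
Proof.
move=> Kcl xK /connectP[p + ->]; elim: p x xK => //= z p IHp x xK.
by case/andP=> /and3P[_ zB xz]; apply: IHp; exact: Kcl xz.
Qed.

Lemma component_connect A K x y :
  K \in components e A -> x \in K ->
  (y \in K) = (y \in A) && connect (induced e A) x y.
Proof.
case/imsetP=> z zA ->; rewrite !inE => /andP[xA zx].
by rewrite !(same_connect (@connect_induced_sym A) zx).
Qed.

(** A path in [A] that starts in [K] never leaves [K], so it survives in the subgraph induced on
    [K]. *)
Lemma component_connected A K x y :
  K \in components e A -> x \in K -> y \in K -> connect (induced e K) x y.
Proof.
move=> KA xK; rewrite (component_connect y KA xK) => /andP[_ /connectP[p + ->]].
elim: p x xK => //= z p IHp x xK /andP[/and3P[xA zA xz] zp].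
have zK : z \in K by exact: component_closed KA xK zA xz.
by apply: connect_trans (IHp z zK zp); apply: connect1; rewrite /induced /= xK zK.
Qed.

Lemma component_nonempty A K : K \in components e A -> exists x, x \in K.
Proof.
by case/imsetP=> x xA ->; exists x; rewrite inE xA connect0.
Qed.

Lemma component_of A x : x \in A -> exists2 K, K \in components e A & x \in K.
Proof.
move=> xA; exists [set y in A | connect (induced e A) x y].
  by apply/imsetP; exists x.
by rewrite inE xA connect0.
Qed.

Lemma component_uniq A K Q x :
  K \in components e A -> Q \in components e A -> x \in K -> x \in Q -> K = Q.
Proof.
move=> KA QA xK xQ; apply/setP=> y.
by rewrite (component_connect y KA xK) (component_connect y QA xQ).
Qed.

Lemma connect_induced_sub A B x y :
  A \subset B -> connect (induced e A) x y -> connect (induced e B) x y.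
Proof.
move=> /subsetP AB; apply: connect_sub => a b /and3P[aA bA ab].
by apply: connect1; rewrite /induced /= !AB.
Qed.

(** A component is a nonempty connected set closed under edges of the ambient set; connectedness is
    intrinsic to [K], so only closure depends on [B]. *)
Lemma component_transfer A B K :
    K \in components e A -> K \subset B ->
    (forall x y, x \in K -> y \in B -> e x y -> y \in K) ->
  K \in components e B.
Proof.
move=> KA KB Kcl; have [x xK] := component_nonempty KA.
have xB := subsetP KB x xK.
apply/imsetP; exists x => //; apply/setP=> y; rewrite inE.
apply/idP/andP=> [yK|[yB]]; last exact: connect_induced_closed.
split; first exact: (subsetP KB).
exact: connect_induced_sub KB (component_connected KA xK yK).
Qed.

Lemma gdist_ge2 i j : gdist_ge e i j 2 = (j \notin star e i).
Proof.
by rewrite inE /gdist_ge /gdist_le; case: gdist => // k; rewrite ltnNge.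
Qed.

Lemma star_sym i j : (j \in star e i) = (i \in star e j).
Proof. by rewrite !in_star eq_sym e_sym. Qed.

Lemma component_notin_star i K k : K \in components e (~: star e i) ->
  k \in K -> k \notin star e i.
Proof. by move=> KA kK; have := subsetP (component_sub KA) k kK; rewrite in_setC. Qed.

(** Since [j] lies outside the star of [i], an edge from [j] to [K] would put [j] in [K]. *)
Lemma component_disjoint_star i j K k : K \in components e (~: star e i) ->
  j \notin star e i -> j \notin K -> k \in K -> k \notin star e j.
Proof.
move=> KA ji jK kK; apply: contra jK; rewrite in_star => /orP[/eqP<- //|jk].
by apply: component_closed KA kK _ _; rewrite ?in_setC // e_sym.
Qed.

Hypothesis (e_irr : irreflexive e).

Lemma has_SIL_of i j K : i \notin star e j ->
  K \in components e (~: (link e i :&: link e j)) -> i \notin K -> j \notin K ->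
  has_SIL e.
Proof.
move=> ij KA iK jK; have := ij; rewrite in_star negb_or => /andP[nij _].
case: (ltngtP i j) => [lt_ij|lt_ji|/val_inj eq_ij]; last by rewrite eq_ij eqxx in nij.
  by exists i, j; rewrite gdist_ge2 -star_sym; split=> //; exists K.
by exists j, i; rewrite gdist_ge2; split=> //; exists K; rewrite // setIC.
Qed.

Lemma component_sub_of_no_SIL i j K Q : ~ has_SIL e -> i \notin star e j ->
    K \in components e (~: star e i) -> j \notin K ->
    Q \in components e (~: star e j) -> i \in Q ->
  K \subset Q.
Proof.
move=> noSIL ij KA jK QA iQ; have ji : j \notin star e i by rewrite star_sym.
have iK : i \notin K.
  by apply/negP=> /(component_notin_star KA); rewrite in_star eqxx.
have KB : K \subset ~: (link e i :&: link e j).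
  apply/subsetP=> k /(component_notin_star KA); rewrite in_star negb_or.
  by rewrite !in_setC in_setI !in_link // => /andP[_ /negbTE->].
(* If no edge left [K] within the complement of the common link, [K] would be a component there
   missing [i] and [j], that is, a SIL. *)
have [k [l [kK lK kl lB]]] : exists k l, [/\ k \in K, l \notin K, e k l &
    l \in ~: (link e i :&: link e j)].
  apply: contra_notP noSIL => noexit; apply: has_SIL_of (ij) _ iK jK.
  apply: component_transfer KA KB _ => x y xK yB xy.
  by apply/negPn/negP => yK; apply: noexit; exists x, y.
have il : e i l.
  have : l \in star e i.
    apply: contraR lK => li; apply: component_closed KA kK _ kl.
    by rewrite in_setC.
  rewrite in_star => /orP[/eqP li|//].
  by have := component_notin_star KA kK; rewrite in_star e_sym -li kl orbT.
have lj : l \notin star e j.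
  rewrite in_star negb_or; apply/andP; split.
    by apply: contra ji => /eqP<-; rewrite in_star il orbT.
  by move: lB; rewrite in_setC in_setI !in_link // il.
(* The path from [i] through [l] to [k] avoids the star of [j], so [K] meets [Q]; as [K] is
   connected and avoids that star too, it lies in [Q]. *)
have lQ : l \in Q by apply: component_closed QA iQ _ il; rewrite in_setC.
have KSj : K \subset ~: star e j.
  by apply/subsetP=> x xK; rewrite in_setC (component_disjoint_star KA ji jK).
have kQ : k \in Q.
  apply: component_closed QA lQ _ _; last by rewrite e_sym.
  exact: (subsetP KSj).
apply/subsetP=> x xK; rewrite (component_connect x QA kQ) (subsetP KSj) //=.
exact: connect_induced_sub KSj (component_connected KA kK xK).
Qed.

(** A neighbour of [i] in [R] would pull [i] into [R], because [i] is not in its own link; so [R]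
    avoids the star. Closure passes to the smaller complement. *)
Lemma SIL_component i j R : i \notin star e j ->
    R \in components e (~: (link e i :&: link e j)) -> i \notin R ->
  R \in components e (~: star e i).
Proof.
move=> ij RA iR.
have RS : R \subset ~: star e i.
  apply/subsetP=> x xR; rewrite in_setC in_star negb_or.
  apply/andP; split; first by apply: contraNneq iR => <-.
  apply: contra iR => ix; apply: component_closed RA xR _ _; last by rewrite e_sym.
  by rewrite in_setC in_setI !in_link // e_irr.
apply: component_transfer (RA) RS _ => x y xR yS xy.
apply: component_closed RA xR _ xy.
move: yS; rewrite !in_setC in_star in_setI !in_link // negb_or.
by case/andP=> _ /negbTE->.
Qed.

Lemma is_j_min_exists i k : k \notin star e i -> exists j, is_j_min e i j.
Proof.
move=> ki; have kS : k \in ~: star e i by rewrite in_setC.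
exists [arg min_(x < k in ~: star e i) x].
by case: arg_minnP => // x xS xmin; split.
Qed.

Lemma is_j_min_uniq i j k : is_j_min e i j -> is_j_min e i k -> j = k.
Proof.
move=> [jS jmin] [kS kmin]; apply/val_inj/eqP.
by rewrite eqn_leq jmin // kmin.
Qed.

End Components.

Local Open Scope group_scope.

(** * Cyclic permutations given by duplicate-free sequences *)

Section CyclePerm.
Variable T : finType.
Implicit Type s : seq T.

Definition cycle_perm s (Us : uniq s) : {perm T} := perm (can_inj (prev_next Us)).

Lemma cycle_permE s (Us : uniq s) x : cycle_perm Us x = next s x.
Proof. by rewrite permE. Qed.

Lemma cycle_perm_out s (Us : uniq s) x : x \notin s -> cycle_perm Us x = x.
Proof. by rewrite cycle_permE next_nth => /negbTE->. Qed.

Lemma cycle_permX s (Us : uniq s) : cycle_perm Us ^+ size s = 1.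
Proof.
apply/permP=> x; rewrite permX perm1.
have [xs|xs] := boolP (x \in s); last first.
  by elim: size => //= n ->; exact: cycle_perm_out.
rewrite (eq_iter (cycle_permE Us)).
(* The orbit of a point of [s] under [next s] is all of [s], so its order is [size s]. *)
rewrite -(order_cycle (cycle_next Us) Us xs).
exact: (iter_order_cycle (cycle_next Us) xs xs).
Qed.

End CyclePerm.

Lemma permV_fix (T : finType) (s : {perm T}) x : s x = x -> s^-1 x = x.
Proof. by move=> {1}<-; rewrite permK. Qed.

(** * Rotations of a wedge of cycles *)

Section Wedge.
Variables (I : finType) (n : I -> nat).
Hypothesis n_gt1 : forall k, (1 < n k)%N.

(* Cycles of lengths [n k] glued at the common point [None]. *)
Definition wedge := option {k : I & 'I_(n k).-1}.

Definition petal k : seq wedge :=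
  None :: [seq Some (Tagged (fun k => 'I_(n k).-1) x) | x <- enum 'I_(n k).-1].

Lemma petal_uniq k : uniq (petal k).
Proof.
rewrite /= map_inj_uniq ?enum_uniq ?andbT; first by apply/mapP=> -[].
by move=> x y [] /eqP; rewrite eq_Tagged => /eqP.
Qed.

Lemma size_petal k : size (petal k) = n k.
Proof. by rewrite /= size_map size_enum_ord prednK // ltnW. Qed.

Definition rotation k : {perm wedge} := cycle_perm (petal_uniq k).

Lemma rotationX k : rotation k ^+ n k = 1.
Proof. by rewrite -(size_petal k) cycle_permX. Qed.

Lemma rotation_root k : rotation k None != None.
Proof.
rewrite cycle_permE /petal; case En: (enum _) => [|x s] //=.
by move: (n_gt1 k) (size_enum_ord (n k).-1); rewrite En; case: (n k) => [|[]].
Qed.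

(** A point moved by [rotation k] lies on petal [k], and distinct petals meet only at the root. *)
Lemma rotation_fix k l x :
  k != l -> x != None -> rotation k x != x -> rotation l x = x.
Proof.
move=> kl xN kx; apply: cycle_perm_out.
have: x \in petal k by apply: contraR kx => /cycle_perm_out->.
rewrite !inE (negbTE xN) /= => /mapP[y _ ->]; apply/mapP=> -[z _ []].
by move=> /eqP; rewrite (negbTE kl).
Qed.

Lemma rotation_other k l : k != l -> rotation l (rotation k None) = rotation k None.
Proof.
move=> kl; apply: rotation_fix kl (rotation_root k) _.
by rewrite (inj_eq perm_inj) rotation_root.
Qed.

Lemma rotationV_root k : (rotation k)^-1 None != None.
Proof.
by rewrite -(inj_eq (@perm_inj _ (rotation k))) permKV eq_sym rotation_root.
Qed.

Lemma rotationV_other k l :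
  k != l -> rotation l ((rotation k)^-1 None) = (rotation k)^-1 None.
Proof.
move=> kl; apply: rotation_fix kl (rotationV_root k) _.
by rewrite permKV eq_sym rotationV_root.
Qed.

Lemma rotation_conj_neq i j : i != j ->
  let a := rotation i in let b := rotation j in
  a * b * a * b^-1 * a^-1 <> b * a * b^-1.
Proof.
move=> ij a b; have ji : j != i by rewrite eq_sym.
(* Permutation products act from left to right. With the last [a^-1] cancelled, the left side sends
   [b^-1 None] to [a None], the right side to [a (a None)]. *)
move=> /(congr1 (mulg^~ a)) /permP/(_ (b^-1 None)).
rewrite mulgVK !permM rotationV_other // permKV -/a.
rewrite !(permV_fix (rotation_other ij)) => /esym/perm_inj/eqP.
by apply/negP/rotation_root.
Qed.

Lemma rotation_root_neq j r : j != r -> rotation r None <> (rotation j)^-1 None.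
Proof.
move=> jr; rewrite -(rotationV_other jr) => /perm_inj/esym/eqP.
by apply/negP/rotationV_root.
Qed.

Lemma rotation_swap_neq i j r : i != j -> i != r -> j != r ->
  let a := rotation i in let b := rotation j in let c := rotation r in
  a * b * c * b^-1 * a^-1 <> b * a * c * a^-1 * b^-1.
Proof.
move=> ij ir jr a b c; have ji : j != i by rewrite eq_sym.
have ri : r != i by rewrite eq_sym.
have rj : r != j by rewrite eq_sym.
(* The left side sends this point to [c None]; the right side fixes it. *)
move=> /permP/(_ (b^-1 None)).
rewrite !permM rotationV_other // permKV.
rewrite (permV_fix (rotation_other rj)) (permV_fix (rotation_other ri)).
by rewrite rotation_other // permK; exact: rotation_root_neq.
Qed.

Lemma rotation_conj_swap_neq i j r : i != j -> i != r -> j != r ->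
  let a := rotation i in let b := rotation j in let c := rotation r in
  a * b * a^-1 * c * a * b^-1 * a^-1 <> b * c * b^-1.
Proof.
move=> ij ir jr a b c; have ji : j != i by rewrite eq_sym.
have rj : r != j by rewrite eq_sym.
(* Here the left side fixes the point and the right side sends it to [c None]. *)
move=> /permP/(_ (b^-1 None)).
rewrite !permM rotationV_other // permKV.
rewrite (rotationV_other ir) permKV (permV_fix (rotation_other rj)).
by rewrite (permV_fix (rotationV_other ji)) => /esym; exact: rotation_root_neq.
Qed.

End Wedge.

Lemma morphV (G H : groupType) (f : G -> H) :
  {morph f : x y / x * y} -> {morph f : x / x^-1}.
Proof.
move=> fM x; have f1 : f 1 = 1 by apply: (mulgI (f 1)); rewrite -fM !mulg1.
by apply: (mulgI (f x)); rewrite -fM !mulgV.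
Qed.

(** * Actions of the graph product and commutation of partial conjugations *)

Section GraphProduct.
Variables (N : nat) (e : rel 'I_N) (m : 'I_N -> option nat).
Implicit Types (i j k : 'I_N) (K Q : {set 'I_N}).
Implicit Types chi psi : Aut (graph_product e m).

Local Notation v := (gp_gen e m).

(* Infinite order is replaced by 2: any order at least 2 would do. *)
Definition rotation_order k : nat := odflt 2%N (m k).

Lemma rotation_order_gt1 k : order_map m -> (1 < rotation_order k)%N.
Proof.
rewrite /rotation_order => m_order; case mk: (m k) => [q|] //=.
have [p [a [p_pr a_gt0 ->]]] := m_order k q mk.
by apply: leq_trans (prime_gt1 p_pr) _; rewrite -{1}[p]expn1 leq_exp2l ?prime_gt1.
Qed.

(** Generators outside [S] act trivially. Every edge has an endpoint outside [S], so the commutation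
    relations hold. *)
Lemma rotation_hom (S : {set 'I_N}) : order_map m ->
    {in S &, forall j k, ~~ e j k} ->
  exists2 phi : graph_product e m -> {perm wedge rotation_order},
    {morph phi : x y / x * y} &
    {in S, forall k, phi (v k) = rotation rotation_order k}.
Proof.
move=> m_order S_indep.
pose f k : {perm wedge rotation_order} :=
  if k \in S then rotation rotation_order k else 1.
have fR x y : gp_rel e m x y -> word_eval f x = word_eval f y.
  case=> {x y} [i k mi|j k jk] /=.
    have -> : word_eval f (nseq k (i, true)) = f i ^+ k.
      by elim: k {mi} => [|k IHk] //=; rewrite IHk expgS.
    rewrite /f; case: ifP => _; last exact: expg1n.
    have <- : rotation_order i = k by rewrite /rotation_order mi.
    by apply: rotationX => l; exact: rotation_order_gt1.
  rewrite !mulg1 /f; case: ifPn => jS; case: ifPn => kS; rewrite ?mulg1 ?mul1g //.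
  by have := S_indep j k jS kS; rewrite jk.
exists (pres_lift f); first exact: pres_liftM fR.
by move=> k kS; rewrite (pres_lift_gen fR) /f kS.
Qed.

Lemma gp_conj_neq i j : order_map m -> i != j ->
    ~~ e i i -> ~~ e j j -> ~~ e i j -> ~~ e j i ->
  v i * v j * v i * (v j)^-1 * (v i)^-1 <> v j * v i * (v j)^-1.
Proof.
move=> m_order ij eii ejj eij eji.
have [|phi phiM phiE] := @rotation_hom [set i; j] m_order.
  by move=> x y; rewrite !inE => /orP[]/eqP-> /orP[]/eqP->.
move=> /(congr1 phi); rewrite !phiM !(morphV phiM) !phiE ?inE ?eqxx ?orbT //.
by apply: rotation_conj_neq ij => k; exact: rotation_order_gt1.
Qed.

Lemma aut_commute chi psi :
  (forall k, chi (psi (v k)) = psi (chi (v k))) -> commute chi psi.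
Proof.
move=> cE; apply: val_inj; apply: pres_hom_ext => // x y /=; by rewrite !autM.
Qed.

Lemma commute_aut chi psi k : commute chi psi -> chi (psi (v k)) = psi (chi (v k)).
Proof. by move=> c; have /(congr1 (fun f : Aut _ => f (v k))) := c. Qed.

(** Each map fixes the conjugator of the other, so the order matters only on generators in both [K]
    and [Q], which are conjugated by [v i] and [v j] in either order. *)
Lemma partial_conj_commute_fixed i j K Q chi psi :
    is_partial_conj i K chi -> is_partial_conj j Q psi ->
    j \notin K -> i \notin Q ->
    (forall k, k \in K -> k \in Q -> commute (v i) (v j)) ->
  commute chi psi.
Proof.
move=> chiE psiE jK iQ cij; apply: aut_commute => k.
rewrite psiE chiE; case: ifPn => kQ; case: ifPn => kK;
  rewrite ?autM ?(morphV (@autM _ _)) ?chiE ?psiE ?(negbTE jK) ?(negbTE iQ)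
    ?kK ?(negbTE kK) ?kQ ?(negbTE kQ) //.
have c := cij k kK kQ.
by rewrite !mulgA -c -!mulgA -!invgM c.
Qed.

(** On [v j] and all generators in [Q], [chi] is conjugation by the single element [v i], and [psi]
    fixes [v i]. *)
Lemma partial_conj_commute_sub i j K Q chi psi :
    is_partial_conj i K chi -> is_partial_conj j Q psi ->
    j \in K -> i \notin Q -> Q \subset K ->
  commute chi psi.
Proof.
move=> chiE psiE jK iQ /subsetP QK; apply: aut_commute => k.
rewrite psiE chiE; have := QK k; case: ifPn => kQ; case: ifPn => kK QKk;
  rewrite ?autM ?(morphV (@autM _ _)) ?chiE ?psiE ?jK ?(negbTE iQ)
    ?kK ?(negbTE kK) ?kQ ?(negbTE kQ) //; last first.
  by have := QKk isT.
by rewrite !invgM !invgK !mulgA !mulgVK.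
Qed.

Hypotheses (e_sym : symmetric e) (e_irr : irreflexive e).

(** These compare the two composites at [v r]: first when both maps conjugate [v r], then when the
    map of [i] conjugates [v j] but not [v r] and the map of [j] conjugates [v r]. *)
Lemma gp_swap_neq i j r : order_map m ->
    j \notin star e i -> r \notin star e i -> r \notin star e j ->
  v i * v j * v r * (v j)^-1 * (v i)^-1 <> v j * v i * v r * (v i)^-1 * (v j)^-1
  /\ v i * v j * (v i)^-1 * v r * v i * (v j)^-1 * (v i)^-1
     <> v j * v r * (v j)^-1.
Proof.
move=> m_order; rewrite !in_star !negb_or !(eq_sym _ i) (eq_sym r j).
move=> /andP[ij eij] /andP[ir eir] /andP[jr ejr].
have [|phi phiM phiE] := @rotation_hom [set i; j; r] m_order.
  move=> x y; rewrite !inE -!orbA => /or3P[]/eqP-> /or3P[]/eqP->;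
    by rewrite ?e_irr // e_sym.
split=> /(congr1 phi); rewrite !phiM !(morphV phiM) !phiE ?inE ?eqxx ?orbT //.
  by apply: rotation_swap_neq => // k; exact: rotation_order_gt1.
by apply: rotation_conj_swap_neq => // k; exact: rotation_order_gt1.
Qed.

Lemma partial_conjs0_commute chi psi : ~ has_SIL e ->
  partial_conjs0 e m chi -> partial_conjs0 e m psi -> commute chi psi.
Proof.
move=> noSIL [i [K [KA chiE Kmin]]] [j [Q [QA psiE Qmin]]].
(* For equal or adjacent vertices, neither lies in the component of the other, and their generators
   commute. *)
have [ij|ij] := boolP (i \in star e j).
  have jK : j \notin K.
    by apply/negP=> /(component_notin_star KA); rewrite star_sym // ij.
  have iQ : i \notin Q by apply/negP=> /(component_notin_star QA); rewrite ij.
  apply: (partial_conj_commute_fixed chiE psiE jK iQ) => _ _ _.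
  move: ij; rewrite in_star => /orP[/eqP->//|ji].
  by apply: gp_genC; rewrite e_sym.
have ji : j \notin star e i by rewrite star_sym.
have subQ := component_sub_of_no_SIL e_sym e_irr noSIL ij.
have subK := component_sub_of_no_SIL e_sym e_irr noSIL ji.
have [jK|jK] := boolP (j \in K); have [iQ|iQ] := boolP (i \in Q).
- have [a amin] := is_j_min_exists ji; have [b bmin] := is_j_min_exists ij.
  have [aS a_le] := amin; have [bS b_le] := bmin.
  have aK := Kmin a amin; have bQ := Qmin b bmin.
  (* The component [K'] of the basepoint [a] differs from [K], hence misses [j] and lies in [Q]. So
     [a] competes in the minimum defining [b], and symmetrically. *)
  have [K' K'A aK'] := component_of e aS; have [Q' Q'A bQ'] := component_of e bS.
  have jK' : j \notin K'.
    by apply: contra aK => jK'; rewrite (component_uniq e_sym KA K'A jK jK').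
  have iQ' : i \notin Q'.
    by apply: contra bQ => iQ'; rewrite (component_uniq e_sym QA Q'A iQ iQ').
  have aQ : a \in Q := subsetP (subQ _ _ K'A jK' QA iQ) a aK'.
  have bK : b \in K := subsetP (subK _ _ Q'A iQ' KA jK) b bQ'.
  have ab : a = b.
    apply/val_inj/eqP; rewrite eqn_leq a_le ?b_le //.
      exact: subsetP (component_sub QA) a aQ.
    exact: subsetP (component_sub KA) b bK.
  by rewrite -ab aQ in bQ.
- exact: partial_conj_commute_sub chiE psiE jK iQ (subK _ _ QA iQ KA jK).
- apply/esym; exact: partial_conj_commute_sub psiE chiE iQ jK (subQ _ _ KA jK QA iQ).
(* A common vertex [k] is impossible: [K] lies in the component [Q'] of [i], so [Q] would equal [Q']
   and contain [i]. *)
apply: (partial_conj_commute_fixed chiE psiE jK iQ) => k kK kQ.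
have [Q' Q'A iQ'] : exists2 Q', Q' \in components e (~: star e j) & i \in Q'.
  by apply: component_of; rewrite in_setC.
have kQ' := subsetP (subQ _ _ KA jK Q'A iQ') k kK.
by move: iQ; rewrite (component_uniq e_sym QA Q'A kQ kQ') iQ'.
Qed.

(* If the basepoint lies in R, it lies in no other component. *)
Lemma partial_conjs0_exists i K R :
    K \in components e (~: star e i) -> R \in components e (~: star e i) ->
    K != R ->
  (exists2 chi, partial_conjs0 e m chi & is_partial_conj i R chi) \/
  (exists2 chi, partial_conjs0 e m chi & is_partial_conj i K chi).
Proof.
move=> KA RA KR.
have [[a amin aR]|noR] := pselect (exists2 a, is_j_min e i a & a \in R).
  right; have [chi chiE] := partial_conj_exists m e_irr e_sym KA.
  exists chi => //; exists i, K; split=> // b bmin.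
  rewrite (is_j_min_uniq bmin amin); apply: contra KR => aK.
  by apply/eqP; exact: (component_uniq e_sym KA RA aK aR).
left; have [chi chiE] := partial_conj_exists m e_irr e_sym RA.
exists chi => //; exists i, R; split=> // b bmin.
by apply/negP=> bR; apply: noR; exists b.
Qed.

Lemma partial_conjs0_noncommuting : order_map m -> has_SIL e ->
  exists chi psi, [/\ partial_conjs0 e m chi, partial_conjs0 e m psi &
    ~ commute chi psi].
Proof.
move=> m_order [i [j [_]]]; rewrite gdist_ge2 => ji [R RA [iR jR]].
have ij : i \notin star e j by rewrite star_sym.
have RAi := SIL_component e_sym e_irr ij RA iR.
have RAj : R \in components e (~: star e j).
  by apply: (@SIL_component _ _ e_sym e_irr j i R ji) => //; rewrite setIC.
have [r rR] := component_nonempty RA.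
have ri := component_notin_star RAi rR; have rj := component_notin_star RAj rR.
have [K KA jK] : exists2 K, K \in components e (~: star e i) & j \in K.
  by apply: component_of; rewrite in_setC.
have [Q QA iQ] : exists2 Q, Q \in components e (~: star e j) & i \in Q.
  by apply: component_of; rewrite in_setC.
have KR : K != R by apply: contraNneq jR => <-.
have QR : Q != R by apply: contraNneq iR => <-.
have rK : r \notin K.
  by apply: contra KR => rK; apply/eqP/(component_uniq e_sym KA RAi rK rR).
have rQ : r \notin Q.
  by apply: contra QR => rQ; apply/eqP/(component_uniq e_sym QA RAj rQ rR).
have iK : i \notin K.
  by apply/negP=> /(component_notin_star KA); rewrite in_star eqxx.
have jQ : j \notin Q.
  by apply/negP=> /(component_notin_star QA); rewrite in_star eqxx.
have [swap_ij conj_ij] := gp_swap_neq m_order ji ri rj.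
(* The second inequality is not symmetric in [i] and [j], so it is taken in both orders. *)
have [_ conj_ji] := gp_swap_neq m_order ij rj ri.
have autMV := (fun f : Aut (graph_product e m) => morphV (@autM _ f)).
case: (partial_conjs0_exists KA RAi KR) => -[chi chi0 chiE];
case: (partial_conjs0_exists QA RAj QR) => -[psi psi0 psiE];
exists chi, psi; split=> // /commute_aut c.
- move: (c r); rewrite psiE chiE rR !autM !autMV chiE psiE.
  rewrite !chiE !psiE rR (negbTE iR) (negbTE jR) !mulgA => /esym; exact: swap_ij.
- move: (c r); rewrite psiE chiE rR (negbTE rQ) !autM !autMV.
  rewrite !chiE !psiE rR (negbTE rQ) iQ !invgM invgK !mulgA => /esym; exact: conj_ji.
- move: (c r); rewrite psiE chiE rR (negbTE rK) !autM !autMV.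
  rewrite !chiE !psiE rR (negbTE rK) jK !invgM invgK !mulgA; exact: conj_ij.
(* With components [K] and [Q] both maps fix [v r], so the composites are compared at [v i]
   instead. *)
move: (c i); rewrite psiE chiE iQ (negbTE iK) !autM !autMV.
rewrite !chiE !psiE (negbTE iK) jK iQ !invgM invgK !mulgA !mulgVK.
apply: gp_conj_neq => //; rewrite ?e_irr //.
- by apply: contraNneq ij => ->; rewrite in_star eqxx.
- by apply: contra ji; rewrite in_star => ->; rewrite orbT.
- by apply: contra ij; rewrite in_star => ->; rewrite orbT.
Qed.

End GraphProduct.

(** Centralizers are subgroups. That of [A] contains [A], hence the generated subgroup; so the
    centralizer of the generated subgroup contains [A], hence that subgroup itself. *)
Lemma subgroup_generated_abelian (G : groupType) (A : set G) :
    (forall x y, A x -> A y -> commute x y) ->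
  abelian_subgroup (subgroup_generated A).
Proof.
move=> cA.
have centr (B : set G) : is_subgroup [set x : G | forall y, B y -> commute y x].
  split=> [y _|x z cx cz y By|x cx y By]; first exact: commute1.
    by apply: commuteM; [exact: cx | exact: cz].
  by apply: commuteV; exact: cx.
have cgen y x : A y -> subgroup_generated A x -> commute y x.
  by move=> Ay genx; apply: (genx _ (conj (centr A) _)) => // z Az w Aw; exact: cA.
move=> x y genx geny; apply: (geny _ (conj (centr (subgroup_generated A)) _)) => //.
by move=> z Az w genw; apply/commute_sym; exact: cgen.
Qed.

Theorem theorem1p10 (N : nat) (N_gt0 : (0 < N)%N)
    (e : rel 'I_N) (e_sym : symmetric e) (e_irr : irreflexive e)
    (m : 'I_N -> option nat) (m_order : order_map m) :
  abelian_subgroup (Out0 e m) <-> ~ has_SIL e.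
Proof.
split=> [abel SIL|noSIL].
  have [chi [psi [chi0 psi0 nc]]] :=
    partial_conjs0_noncommuting e_sym e_irr m_order SIL.
  by apply: nc; apply: abel => M [_]; apply.
apply: subgroup_generated_abelian => chi psi.
exact: partial_conjs0_commute.
Qed.
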